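(* Let $K$ be any regular polygonal knot diagram, with any folding information $F$. Then there is a constant $M>0$ such that an allowed folded ribbon knot $K_{w,F}$ exists for all widths $w<M$.
   Context: A polygonal knot has finitely many vertices $v_1,\dots,v_n$ and edges $e_1=[v_1,v_2],\dots,e_n=[v_n,v_1]$. A polygonal knot diagram is a projection of a polygonal knot to a plane in which the crossing information of overlapping strands is preserved. It is regular if no three points on the knot project to the same point and no vertex projects to the same point as any other point on the knot. Given an oriented polygonal knot diagram $K$, the fold angle at $v_i$ is the angle $\theta_i\in[0,\pi]$ between $e_{i-1}$ and $e_i$. The folded ribbon knot of width $w>0$ with centerline $K$ is constructed as follows: at each vertex with $\theta_i<\pi$ place a fold line of length $w/\cos(\theta_i/2)$ centered at $v_i$ and perpendicular to the bisector of $\theta_i$ (no fold line if $\theta_i=\pi$); then add the ribbon boundaries by joining the ends of the fold lines at $v_i$ and $v_{i+1}$. At each fold one chooses whether the piece of ribbon of $e_i$ lies over (overfold) or under (underfold) the piece of ribbon of $e_{i-1}$; these choices constitute the folding information $F$, and the folded ribbon knot of width $w$ with folding information $F$ is denoted $K_{w,F}$. $K_{w,F}$ is allowed if: (1) the ribbon (a piecewise linear image of an annulus or Möbius band in the plane) has no singularities (is immersed) except at the fold lines, which are disjoint; (2) $K_{w,F}$ has consistent crossing (over/under) information, and moreover this agrees (a) with the folding information given by $F$ and (b) with the crossing information of the knot diagram $K$. *)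

(* Defs.v *)
From mathcomp Require Import all_boot all_order all_algebra.
From mathcomp Require Import all_classical all_reals all_analysis.

Set Implicit Arguments.
Unset Strict Implicit.
Unset Printing Implicit Defensive.

Import Order.TTheory GRing.Theory Num.Theory.
Local Open Scope ring_scope.

(* The library norm on row vectors is the sup norm, hence [enorm]. *)
Definition dotp (R : realType) (m : nat) (u v : 'rV[R]_m) : R :=
  \sum_(k < m) u 0 k * v 0 k.

Definition enorm (R : realType) (m : nat) (u : 'rV[R]_m) : R :=
  Num.sqrt (dotp u u).

Definition dirv (R : realType) (m : nat) (u : 'rV[R]_m) : 'rV[R]_m :=
  (enorm u)^-1 *: u.

(* Counterclockwise rotation by a right angle. *)
Definition rot90 (R : realType) (u : 'rV[R]_2) : 'rV[R]_2 :=
  \row_(k < 2) (if k == 0 then - u 0 1 else u 0 0).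

(* The knot lives in space, the plane of the diagram is that of the first two
   coordinates, and the third coordinate (the height) carries the crossing
   information: the higher strand is the over-strand.
   Vertices are indexed cyclically by 'I_n, [ordS] and [ord_pred] being the
   cyclic successor and predecessor; the edge e_i goes from v_i to v_(i+1),
   which also fixes the orientation of the knot. *)
Definition proj (R : realType) (p : 'rV[R]_3) : 'rV[R]_2 :=
  lsubmx (p : 'rV[R]_(2 + 1)).

Definition height (R : realType) (p : 'rV[R]_3) : R := p 0 ord_max.

Definition edge_pt (R : realType) (n : nat) (v : 'I_n -> 'rV[R]_3)
    (i : 'I_n) (s : R) : 'rV[R]_3 :=
  (1 - s) *: v i + s *: v (ordS i).

Definition on_knot (R : realType) (n : nat) (v : 'I_n -> 'rV[R]_3)
    (p : 'rV[R]_3) : Prop :=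
  exists (i : 'I_n) (s : R), 0 <= s <= 1 /\ p = edge_pt v i s.

(* The closed polygon is embedded. Every point of the closed polygon is
   parametrized once by an edge and a parameter in the half-open [0, 1). *)
Definition polygonal_knot (R : realType) (n : nat) (v : 'I_n -> 'rV[R]_3) :
    Prop :=
  (2 < n)%N /\
  forall (i j : 'I_n) (s t : R), 0 <= s < 1 -> 0 <= t < 1 ->
    edge_pt v i s = edge_pt v j t -> i = j /\ s = t.

Definition regular_diagram (R : realType) (n : nat) (v : 'I_n -> 'rV[R]_3) :
    Prop :=
  (forall p q r : 'rV[R]_3, on_knot v p -> on_knot v q -> on_knot v r ->
     proj p = proj q -> proj q = proj r -> p = q \/ q = r \/ p = r) /\
  (forall (i : 'I_n) (p : 'rV[R]_3), on_knot v p ->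
     proj p = proj (v i) -> p = v i).

Definition pvertex (R : realType) (n : nat) (v : 'I_n -> 'rV[R]_3) (i : 'I_n) :
    'rV[R]_2 := proj (v i).

Definition to_next (R : realType) (n : nat) (v : 'I_n -> 'rV[R]_3)
    (i : 'I_n) : 'rV[R]_2 := pvertex v (ordS i) - pvertex v i.

Definition to_prev (R : realType) (n : nat) (v : 'I_n -> 'rV[R]_3)
    (i : 'I_n) : 'rV[R]_2 := pvertex v (ord_pred i) - pvertex v i.

Definition fold_angle (R : realType) (n : nat) (v : 'I_n -> 'rV[R]_3)
    (i : 'I_n) : R :=
  acos (dotp (to_prev v i) (to_next v i)
          / (enorm (to_prev v i) * enorm (to_next v i))).

Definition has_fold (R : realType) (n : nat) (v : 'I_n -> 'rV[R]_3)
    (i : 'I_n) : bool := fold_angle v i < pi.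

Definition bisector (R : realType) (n : nat) (v : 'I_n -> 'rV[R]_3)
    (i : 'I_n) : 'rV[R]_2 := dirv (to_prev v i) + dirv (to_next v i).

Definition fold_length (R : realType) (n : nat) (v : 'I_n -> 'rV[R]_3)
    (w : R) (i : 'I_n) : R := w / cos (fold_angle v i / 2).

(* The ribbon crosses v_i along the segment from v_i - h to v_i + h, where
   h = [half_section v w i]. If the fold angle is < pi this is the fold line;
   otherwise there is no fold, and the segment is merely the perpendicular
   cross-section at which the strips of e_(i-1) and e_i, lying on one line, are
   juxtaposed. In both cases v_i + h is on the left of the oriented edge e_i. *)
Definition half_section (R : realType) (n : nat) (v : 'I_n -> 'rV[R]_3)
    (w : R) (i : 'I_n) : 'rV[R]_2 :=
  if has_fold v i
  then (fold_length v w i / 2) *: dirv (rot90 (bisector v i))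
  else (w / 2) *: dirv (rot90 (to_next v i)).

Definition fold_line (R : realType) (n : nat) (v : 'I_n -> 'rV[R]_3)
    (w : R) (i : 'I_n) (p : 'rV[R]_2) : Prop :=
  exists t : R, -1 <= t <= 1 /\ p = pvertex v i + t *: half_section v w i.

(* A fold exchanges the two sides of the ribbon: the end of the fold line that
   lies on the left of e_i lies on the right of e_(i-1). *)
Definition side_change (R : realType) (n : nat) (v : 'I_n -> 'rV[R]_3)
    (i : 'I_n) : R := if has_fold v i then -1 else 1.

(* The ribbon as an abstract surface: a point is given by an edge, a parameter
   in [0, 1] along that edge, and a parameter in [-1, 1] across the ribbon
   (1 on the left of the edge, -1 on its right, 0 on the centerline). *)
Record rpoint (R : realType) (n : nat) : Type :=
  RPoint { edge_of : 'I_n ; along : R ; across : R }.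

Definition in_ribbon (R : realType) (n : nat) (x : rpoint R n) : Prop :=
  0 <= along x <= 1 /\ -1 <= across x <= 1.

Definition glued_next (R : realType) (n : nat) (v : 'I_n -> 'rV[R]_3)
    (x y : rpoint R n) : Prop :=
  [/\ along x = 1, edge_of y = ordS (edge_of x), along y = 0
    & across y = side_change v (edge_of y) * across x].

(* Equality in the annulus or Moebius band obtained by gluing the strips of
   consecutive edges; a gluing class has at most two elements when n > 1. *)
Definition same_rpoint (R : realType) (n : nat) (v : 'I_n -> 'rV[R]_3)
    (x y : rpoint R n) : Prop :=
  x = y \/ glued_next v x y \/ glued_next v y x.

(* The map of the ribbon to the plane. The sides across = 1 and across = -1 of
   the strip of e_i are the ribbon boundaries, joining the ends of the fold
   lines at v_i and v_(i+1) that lie on the same side of e_i. *)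
Definition ribbon_map (R : realType) (n : nat) (v : 'I_n -> 'rV[R]_3)
    (w : R) (x : rpoint R n) : 'rV[R]_2 :=
  let i := edge_of x in let j := ordS i in
  (1 - along x) *: (pvertex v i + across x *: half_section v w i)
  + along x *: (pvertex v j
                + (side_change v j * across x) *: half_section v w j).

Definition rclose (R : realType) (n : nat) (e : R) (x y : rpoint R n) : Prop :=
  [/\ edge_of x = edge_of y, `|along x - along y| < e
    & `|across x - across y| < e].

Definition on_fold (R : realType) (n : nat) (v : 'I_n -> 'rV[R]_3)
    (x : rpoint R n) : Prop :=
  (along x = 0 /\ has_fold v (edge_of x)) \/
  (along x = 1 /\ has_fold v (ordS (edge_of x))).

(* A piecewise linear map is an immersion where it is locally injective. A
   neighbourhood in the glued surface is the union of neighbourhoods of the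
   representatives, whence the quantification over two representatives of one
   point. *)
Definition immersed_off_folds (R : realType) (n : nat)
    (v : 'I_n -> 'rV[R]_3) (w : R) : Prop :=
  forall x y : rpoint R n, in_ribbon x -> in_ribbon y ->
    same_rpoint v x y -> ~ on_fold v x ->
    exists2 e : R, 0 < e &
      forall x' y' : rpoint R n, in_ribbon x' -> in_ribbon y' ->
        rclose e x x' -> rclose e y y' ->
        ribbon_map v w x' = ribbon_map v w y' -> same_rpoint v x' y'.

Definition disjoint_folds (R : realType) (n : nat)
    (v : 'I_n -> 'rV[R]_3) (w : R) : Prop :=
  forall i j : 'I_n, i != j -> has_fold v i -> has_fold v j ->
    forall p : 'rV[R]_2, fold_line v w i p -> ~ fold_line v w j p.

Definition double_point (R : realType) (n : nat) (v : 'I_n -> 'rV[R]_3)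
    (w : R) (x y : rpoint R n) : Prop :=
  [/\ in_ribbon x, in_ribbon y, ~ same_rpoint v x y
    & ribbon_map v w x = ribbon_map v w y].

(* Crossing information for the ribbon: [over x y] says that the layer of x is
   over the layer of y, where x and y are distinct points of the ribbon with
   the same image. It is consistent if it is well defined on the glued surface,
   strictly orders the layers above each point of the plane, and does not jump:
   it is locally constant on the space of double points. Since that space
   contains the pairs with a member on a fold line, this prevents layers from
   piercing one another and a layer from passing between two layers that are
   joined by a fold. *)
Definition consistent_crossings (R : realType) (n : nat)
    (v : 'I_n -> 'rV[R]_3) (w : R) (over : rpoint R n -> rpoint R n -> Prop) :
    Prop :=
  [/\ forall x x' y y' : rpoint R n,
        double_point v w x y -> double_point v w x' y' ->
        same_rpoint v x x' -> same_rpoint v y y' -> over x y -> over x' y',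
      forall x y : rpoint R n, double_point v w x y ->
        (over x y <-> ~ over y x),
      forall x y z : rpoint R n,
        double_point v w x y -> double_point v w y z ->
        over x y -> over y z -> over x z
    & forall x y : rpoint R n, double_point v w x y ->
        exists2 e : R, 0 < e &
          forall x' y' : rpoint R n, double_point v w x' y' ->
            rclose e x x' -> rclose e y y' -> (over x' y' <-> over x y)].

Variant folding : Type := Overfold | Underfold.

Definition agrees_with_folding (R : realType) (n : nat)
    (v : 'I_n -> 'rV[R]_3) (F : 'I_n -> folding) (w : R)
    (over : rpoint R n -> rpoint R n -> Prop) : Prop :=
  forall x y : rpoint R n, double_point v w x y ->
    edge_of y = ord_pred (edge_of x) -> has_fold v (edge_of x) ->
    match F (edge_of x) with
    | Overfold => over x y
    | Underfold => over y x
    end.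

Definition knot_pt (R : realType) (n : nat) (v : 'I_n -> 'rV[R]_3)
    (x : rpoint R n) : 'rV[R]_3 := edge_pt v (edge_of x) (along x).

Definition agrees_with_diagram (R : realType) (n : nat)
    (v : 'I_n -> 'rV[R]_3) (w : R)
    (over : rpoint R n -> rpoint R n -> Prop) : Prop :=
  forall x y : rpoint R n, double_point v w x y ->
    across x = 0 -> across y = 0 ->
    (over x y <-> height (knot_pt v y) < height (knot_pt v x)).

Definition allowed (R : realType) (n : nat) (v : 'I_n -> 'rV[R]_3)
    (F : 'I_n -> folding) (w : R) : Prop :=
  [/\ immersed_off_folds v w,
      disjoint_folds v w
    & exists over : rpoint R n -> rpoint R n -> Prop,
        [/\ consistent_crossings v w over,
            agrees_with_folding v F w over
          & agrees_with_diagram v w over]].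

(* Main.v *)
(* Write g for the half-section of width 1 at a vertex. Its component normal to
   either incident edge is 1/2, so the strip of an edge is a trapezoid, embedded
   when w is small, and strips of adjacent unfolded edges only share their
   common section. By regularity no point of the plane lies on three edges, so
   by compactness no point lies on three strips when w is small. As a section
   lies on two strips, it meets no other strip: fold lines are disjoint and
   double points avoid the sections. Hence the over/under relation can be
   defined edge by edge, by F for adjacent edges and by the unique crossing for
   the others, and transitivity over three distinct layers is vacuous. *)
Require Import Defs.
From mathcomp Require Import all_boot all_order all_algebra.
From mathcomp Require Import all_classical all_reals all_analysis.
From mathcomp Require Import ring lra zify.

Set Implicit Arguments.
Unset Strict Implicit.
Unset Printing Implicit Defensive.

Import Order.TTheory GRing.Theory Num.Theory.
Import numFieldNormedType.Exports.
Local Open Scope ring_scope.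

(** * Euclidean geometry of plane row vectors *)

Section PlaneVectors.
Variable R : realType.
Implicit Types (u v : 'rV[R]_2) (a : R).

Lemma dotp2E u v : dotp u v = u 0 0 * v 0 0 + u 0 1 * v 0 1.
Proof.
rewrite /dotp big_ord_recl big_ord_recl big_ord0 addr0.
by congr (_ + u 0 _ * v 0 _); apply/val_inj.
Qed.

Lemma rot90_0 u : rot90 u 0 0 = - u 0 1.
Proof. by rewrite mxE. Qed.

Lemma rot90_1 u : rot90 u 0 1 = u 0 0.
Proof. by rewrite mxE. Qed.

Lemma rvD u v k : (u + v) 0 k = u 0 k + v 0 k.
Proof. exact: mxE. Qed.

Lemma rvN u k : (- u) 0 k = - u 0 k.
Proof. exact: mxE. Qed.

Lemma rvZ a u k : (a *: u) 0 k = a * u 0 k.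
Proof. exact: mxE. Qed.

Definition dotpE := (dotp2E, rot90_0, rot90_1, rvD, rvN, rvZ).

Lemma sqr_enorm u : enorm u ^+ 2 = dotp u u.
Proof. by rewrite sqr_sqrtr // dotp2E; nra. Qed.

Lemma enorm_gt0 u : u != 0 -> 0 < enorm u.
Proof.
move=> u0; rewrite sqrtr_gt0 dotp2E.
suff : (u 0 0 != 0) || (u 0 1 != 0).
  by case/orP; rewrite neq_lt => /orP[] ?; nra.
rewrite -negb_and; apply: contra u0 => /andP[/eqP u00 /eqP u01].
apply/eqP/rowP => k; rewrite mxE; case: k => -[|[|//]] lk.
  by rewrite -[RHS]u00; congr (u 0 _); apply/val_inj.
by rewrite -[RHS]u01; congr (u 0 _); apply/val_inj.
Qed.

Lemma dotp_dirv u : u != 0 -> dotp (dirv u) (dirv u) = 1.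
Proof.
move=> /enorm_gt0 u0; have := sqr_enorm u.
rewrite /dirv !dotpE => uE.
have -> : forall b : R, b * u 0 0 * (b * u 0 0) + b * u 0 1 * (b * u 0 1) =
  b ^+ 2 * (u 0 0 * u 0 0 + u 0 1 * u 0 1) by move=> b; ring.
by rewrite -uE -exprMn mulVf ?expr1n// gt_eqF.
Qed.

Lemma dirvK u : u != 0 -> enorm u *: dirv u = u.
Proof. by move=> /enorm_gt0 u0; rewrite scalerA divff ?scale1r// gt_eqF. Qed.

Lemma dotp_dirv_dirv u v :
  dotp (dirv u) (dirv v) = dotp u v / (enorm u * enorm v).
Proof. by rewrite !dotpE invfM; ring. Qed.

End PlaneVectors.

(** The sum of distances is continuous on a compact cube, so it attains its minimum there. That
    minimum is positive, because a zero would be a point common to the three curves. *)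
Lemma separated_curves (R : realType) (V : normedModType R) (P Q S : R -> V) :
  continuous P -> continuous Q -> continuous S ->
  (forall s t u, 0 <= s <= 1 -> 0 <= t <= 1 -> 0 <= u <= 1 ->
     P s = Q t -> Q t <> S u) ->
  exists2 m : R, 0 < m & forall s t u, 0 <= s <= 1 -> 0 <= t <= 1 ->
    0 <= u <= 1 -> m <= `|P s - Q t| + `|Q t - S u|.
Proof.
move=> cP cQ cS PQS.
pose I : set R := [set` `[0, 1]%R]%classic.
have cI : compact I by exact: segment_compact.
pose f (z : R * R * R) := `|P z.1.1 - Q z.1.2| + `|Q z.1.2 - S z.2|.
have cf : continuous f.
  move=> z; have c11 : continuous (fun z : R * R * R => z.1.1).
    by move=> y; apply: (@continuous_comp _ _ _ fst fst); exact: cvg_fst.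
  have c12 : continuous (fun z : R * R * R => z.1.2).
    by move=> y; apply: (@continuous_comp _ _ _ fst snd); [exact: cvg_fst|exact: cvg_snd].
  have c2 : continuous (fun z : R * R * R => z.2) by move=> y; exact: cvg_snd.
  have c (g : R * R * R -> R) (h : R -> V) : continuous h -> continuous g ->
      continuous (fun z : R * R * R => h (g z)).
    by move=> ch cg y; apply: (@continuous_comp _ _ _ g h); [exact: cg|exact: ch].
  by apply: cvgD; apply: cvg_norm; apply: cvgB; apply: c.
have I0 : I 0 by rewrite /I /= in_itv/= lexx ler01.
have [|||c cI3 cmin] := @compact_EVT_min _ R f (I `*` I `*` I)%classic.
- by exists (0, 0, 0).
- by do !apply: compact_setX.
- exact/continuous_subspaceT.
move: cI3; rewrite inE => -[[/= c11 c12] c2].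
rewrite /I /= !in_itv/= in c11 c12 c2.
exists (f c) => [|s t u s01 t01 u01]; last first.
  by apply: (cmin (s, t, u)); rewrite inE /I; split; [split|]; rewrite /= in_itv.
rewrite lt_neqAle addr_ge0// andbT eq_sym paddr_eq0// !normr_eq0 !subr_eq0.
apply/negP => /andP[/eqP PQ /eqP QS].
exact: (PQS _ _ _ c11 c12 c2 PQ QS).
Qed.

(** * Half-sections at a vertex and their components along the incident edges *)

(** Since [rot90] is an isometry, both products reduce to [1 + dotp x y], which the scalar
    normalizes. The minus sign is the exchange of sides at a fold. *)
Lemma dotp_rot90_bisector (R : realType) (x y : 'rV[R]_2) :
  dotp x x = 1 -> dotp y y = 1 -> 0 < 1 + dotp x y ->
  dotp ((1 / (2 * (1 + dotp x y))) *: rot90 (x + y)) (rot90 y) = 1 / 2 /\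
  dotp (- ((1 / (2 * (1 + dotp x y))) *: rot90 (x + y))) (rot90 x) = - (1 / 2).
Proof.
move=> x1 y1 xy0; set k := 1 / _.
have kE : k * (1 + dotp x y) = 1 / 2 by rewrite /k; field; rewrite gt_eqF.
have kx : k * dotp x x = k by rewrite x1 mulr1.
have ky : k * dotp y y = k by rewrite y1 mulr1.
by rewrite !dotpE in kx ky kE *; split; lra.
Qed.

Lemma dotp_rot90Z (R : realType) (x y : 'rV[R]_2) (a : R) :
  dotp x (rot90 (a *: y)) = a * dotp x (rot90 y).
Proof. by rewrite !dotpE; ring. Qed.

Section Sections.
Variables (R : realType) (n : nat) (v : 'I_n -> 'rV[R]_3).
Implicit Types (i : 'I_n) (w : R).

Lemma half_sectionZ w i : half_section v w i = w *: half_section v 1 i.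
Proof.
by rewrite /half_section /fold_length; case: ifP => _;
  rewrite scalerA; congr (_ *: _); ring.
Qed.

Lemma side_change_sqr i : side_change v i * side_change v i = 1.
Proof. by rewrite /side_change; case: ifP => _; rewrite ?mulrNN mulr1. Qed.

Lemma to_prev_ordS i : to_prev v (ordS i) = - to_next v i.
Proof. by rewrite /to_prev ordSK opprB. Qed.

Variable i : 'I_n.
Hypotheses (prev0 : to_prev v i != 0) (next0 : to_next v i != 0).

Local Notation u := (dirv (to_prev v i)).
Local Notation u' := (dirv (to_next v i)).

Lemma dotp_dirv_bound : -1 <= dotp u u' <= 1.
Proof.
have := dotp_dirv prev0; have := dotp_dirv next0; rewrite !dotp2E.
move=> h1 h2.
have := sqr_ge0 (u 0 0 - u' 0 0); have := sqr_ge0 (u 0 1 - u' 0 1).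
have := sqr_ge0 (u 0 0 + u' 0 0); have := sqr_ge0 (u 0 1 + u' 0 1).
by move=> *; apply/andP; split; lra.
Qed.

Lemma cos_fold_angle : cos (fold_angle v i) = dotp u u'.
Proof.
by rewrite /fold_angle -dotp_dirv_dirv acosK// in_itv/= dotp_dirv_bound.
Qed.

Lemma fold_angle_bound : 0 <= fold_angle v i <= pi.
Proof.
rewrite /fold_angle -dotp_dirv_dirv.
by rewrite acos_ge0 ?dotp_dirv_bound// acos_lepi ?dotp_dirv_bound.
Qed.

(** By the half-angle formula [1 + cos t = 2 * cos (t / 2) ^+ 2], the bisector has length
    [2 * cos (t / 2)], so the trigonometric fold length becomes rational in a dot product. A fold
    angle below [pi] keeps this cosine positive. *)
Lemma half_section_fold w : has_fold v i -> 0 < 1 + dotp u u' /\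
  half_section v w i = (w / (2 * (1 + dotp u u'))) *: rot90 (bisector v i).
Proof.
move=> foldi; have /andP[ge0 _] := fold_angle_bound.
have C0 : 0 < cos (fold_angle v i / 2).
  by apply: cos_gt0_pihalf; move: foldi; rewrite /has_fold => ?; have := pi_gt0 R; lra.
have CE : 1 + dotp u u' = 2 * cos (fold_angle v i / 2) ^+ 2.
  rewrite -cos_fold_angle {1}(_ : fold_angle v i = (fold_angle v i / 2) *+ 2).
    by rewrite cos_mulr2n; ring.
  by rewrite mulr2n; lra.
have bE : enorm (rot90 (bisector v i)) = 2 * cos (fold_angle v i / 2).
  have -> : enorm (rot90 (bisector v i)) = Num.sqrt (2 * (1 + dotp u u')).
    congr Num.sqrt; rewrite /bisector.
    have := dotp_dirv prev0; have := dotp_dirv next0; rewrite !dotpE.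
    by move=> h1 h2; lra.
  rewrite CE (_ : _ * _ = (2 * cos (fold_angle v i / 2)) ^+ 2); last by ring.
  by rewrite sqrtr_sqr ger0_norm//; lra.
split; first by rewrite CE; nra.
rewrite /half_section foldi /dirv bE scalerA CE /fold_length.
by congr (_ *: _); field; rewrite gt_eqF.
Qed.

Lemma side_change_fold : has_fold v i -> side_change v i = -1.
Proof. by rewrite /side_change => ->. Qed.

Lemma side_change_unfold : ~~ has_fold v i -> side_change v i = 1.
Proof. by rewrite /side_change => /negbTE ->. Qed.

Lemma half_section_unfold w : ~~ has_fold v i ->
  half_section v w i = (w / 2) *: dirv (rot90 (to_next v i)).
Proof. by rewrite /half_section => /negbTE ->. Qed.

Lemma dirv_rot90 (x : 'rV[R]_2) : dirv (rot90 x) = rot90 (dirv x).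
Proof.
have -> : dirv (rot90 x) = (enorm x)^-1 *: rot90 x.
  by congr (_^-1 *: _); congr Num.sqrt; rewrite !dotpE; ring.
by apply/rowP => k; rewrite !mxE; case: ifP => _; ring.
Qed.

(** Without a fold the angle is exactly [pi], so the two unit vectors have dot product -1 and their
    sum has squared length 0. *)
Lemma dirv_unfold : ~~ has_fold v i -> u = - u'.
Proof.
rewrite /has_fold -leNgt => pile; have /andP[_ lepi] := fold_angle_bound.
have := cos_fold_angle; rewrite (_ : fold_angle v i = pi); last first.
  by apply/eqP; rewrite eq_le pile lepi.
rewrite cospi.
have := dotp_dirv prev0; have := dotp_dirv next0; rewrite !dotp2E => h1 h2 h3.
have := sqr_ge0 (u 0 0 + u' 0 0); have := sqr_ge0 (u 0 1 + u' 0 1) => s1 s0.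
have h0 : u 0 0 + u' 0 0 = 0 by apply/eqP; rewrite -sqrf_eq0; apply/eqP; lra.
have h4 : u 0 1 + u' 0 1 = 0 by apply/eqP; rewrite -sqrf_eq0; apply/eqP; lra.
apply/eqP; rewrite -addr_eq0; apply/eqP/rowP => k.
rewrite mxE [RHS]mxE; case: k => -[|[|//]] lk.
  by rewrite -[RHS]h0; congr (u 0 _ + u' 0 _); apply/val_inj.
by rewrite -[RHS]h4; congr (u 0 _ + u' 0 _); apply/val_inj.
Qed.

(** This makes the boundaries of a strip parallel to its edge. The second value is negative because
    [u] points against the orientation of the knot. *)
Lemma dotp_half_dirv : dotp (half_section v 1 i) (rot90 u') = 1 / 2 /\
  dotp (side_change v i *: half_section v 1 i) (rot90 u) = - (1 / 2).
Proof.
have [foldi|unfoldi] := boolP (has_fold v i).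
  have [K0 ->] := half_section_fold 1 foldi; rewrite side_change_fold//.
  have [h1 h2] := dotp_rot90_bisector (dotp_dirv prev0) (dotp_dirv next0) K0.
  by split; rewrite ?scaleN1r.
rewrite half_section_unfold// side_change_unfold// dirv_unfold// dirv_rot90 scale1r.
by have := dotp_dirv next0; move: u' => x; rewrite !dotpE => h1; split; lra.
Qed.

Lemma dotp_half_next :
  dotp (half_section v 1 i) (rot90 (to_next v i)) = enorm (to_next v i) / 2.
Proof.
have [h _] := dotp_half_dirv.
rewrite (_ : rot90 (to_next v i) = rot90 (enorm (to_next v i) *: u')).
  by rewrite dotp_rot90Z h; ring.
by rewrite dirvK.
Qed.

Lemma dotp_half_prev :
  dotp (side_change v i *: half_section v 1 i) (rot90 (to_prev v i)) =
  - (enorm (to_prev v i) / 2).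
Proof.
have [_ h] := dotp_half_dirv.
rewrite (_ : rot90 (to_prev v i) = rot90 (enorm (to_prev v i) *: u)).
  by rewrite dotp_rot90Z h; ring.
by rewrite dirvK.
Qed.

Lemma dotp_half_unfold : ~~ has_fold v i ->
  dotp (half_section v 1 i) (to_next v i) = 0 /\
  dotp (half_section v 1 i) (to_prev v i) = 0.
Proof.
move=> unfoldi; rewrite half_section_unfold// dirv_rot90.
rewrite (_ : to_prev v i = - (enorm (to_prev v i) *: u')).
  rewrite (_ : dotp _ (to_next v i) =
      dotp ((1 / 2) *: rot90 u') (enorm (to_next v i) *: u')).
    by move: u' => x; rewrite !dotpE; split; ring.
  by rewrite dirvK.
by rewrite -scalerN -dirv_unfold// dirvK.
Qed.

End Sections.

(** * Cyclic indices and motion in the unit square *)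

Lemma ordS_neq n (i : 'I_n) : (1 < n)%N -> ordS i != i.
Proof.
move=> n1; rewrite -val_eqE /=; have := ltn_ord i.
rewrite leq_eqVlt => /orP[/eqP iE|lt_in]; last by rewrite modn_small//; lia.
by rewrite iE modnn; lia.
Qed.

Lemma ordS2_neq n (i : 'I_n) : (2 < n)%N -> ordS (ordS i) != i.
Proof.
move=> n2; rewrite -val_eqE /= -addn1 modnDml addn1; have := ltn_ord i.
case: (ltnP i.+2 n) => [lt_in|le_ni lt_in]; first by rewrite modn_small//; lia.
have -> : (i.+2 = n + (i.+2 - n))%N by lia.
by rewrite modnDl modn_small; lia.
Qed.

(** The point [(s, t)] moves along [(a, b)] until it reaches a side of the unit square. The boolean
    [0 < a], read as a number, is the end of the unit interval towards which the first coordinate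
    moves; likewise for [b]. *)
Lemma square_exit (R : realFieldType) (s t a b : R) :
  0 <= s <= 1 -> 0 <= t <= 1 -> a != 0 -> b != 0 ->
  exists2 l : R, 0 <= s + l * a <= 1 /\ 0 <= t + l * b <= 1 &
    s + l * a = (0 < a)%R%:R \/ t + l * b = (0 < b)%R%:R.
Proof.
have hit (x c : R) : 0 <= x <= 1 -> c != 0 -> exists2 l, 0 <= l &
    x + l * c = (0 < c)%R%:R /\ forall k, 0 <= k <= l -> 0 <= x + k * c <= 1.
  move=> x01 c0; exists (((0 < c)%R%:R - x) / c).
    case: ltrgt0P c0 => // c0 _; first by rewrite divr_ge0//=; lra.
    by rewrite -mulrNN -invrN divr_ge0//=; lra.
  have E : ((0 < c)%R%:R - x) / c * c = (0 < c)%R%:R - x by rewrite divfK.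
  split; first by rewrite E; ring.
  move=> k; set l := _ / c in E *; move: E c0.
  by case: ltrgt0P => //= c0 E _ kl; apply/andP; split; nra.
move=> s01 t01 a0 b0.
have [l l0 [ls lS]] := hit _ _ s01 a0; have [m m0 [mt mT]] := hit _ _ t01 b0.
(* Stopping at the earlier exit time keeps the other coordinate within bounds. *)
have [lm|ml] := leP l m.
  by exists l; [split; [apply: lS|apply: mT]; lra|left].
by exists m; [split; [apply: lS|apply: mT]; lra|right].
Qed.

(** * Crossings of the projected edges *)

Section Knot.
Variables (R : realType) (n : nat) (v : 'I_n -> 'rV[R]_3).
Hypotheses (knot : polygonal_knot v) (reg : regular_diagram v).
Implicit Types (i j k m : 'I_n) (s t u a b : R).

Lemma edge_pt0 i : edge_pt v i 0 = v i.
Proof. by rewrite /edge_pt subr0 scale1r scale0r addr0. Qed.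

Lemma edge_pt1 i : edge_pt v i 1 = v (ordS i).
Proof. by rewrite /edge_pt subrr scale1r scale0r add0r. Qed.

Lemma proj_edge_pt i s : Defs.proj (edge_pt v i s) =
  (1 - s) *: pvertex v i + s *: pvertex v (ordS i).
Proof. by rewrite /Defs.proj /edge_pt linearD !linearZ. Qed.

Lemma proj_edge_ptD i s a :
  Defs.proj (edge_pt v i (s + a)) = Defs.proj (edge_pt v i s) + a *: to_next v i.
Proof.
rewrite !proj_edge_pt /to_next; move: (pvertex _ _) (pvertex _ _) => x y.
by apply/rowP => k; rewrite !(rvD, rvN, rvZ); ring.
Qed.

Lemma on_edge i s : 0 <= s <= 1 -> on_knot v (edge_pt v i s).
Proof. by move=> s01; exists i, s. Qed.

Lemma on_vertex i : on_knot v (v i).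
Proof. by exists i, 0; rewrite edge_pt0 lexx ler01. Qed.

(** Embeddedness is stated for half-open edges, so the parameter 1 is read as the start of the next
    edge. *)
Lemma edge_vertex i m s : 0 <= s <= 1 -> edge_pt v i s = v m ->
  (i = m /\ s = 0) \/ (ordS i = m /\ s = 1).
Proof.
case: knot => _ inj /andP[s0]; rewrite le_eqVlt => /orP[/eqP -> |s1].
  rewrite edge_pt1 -!edge_pt0 => /inj[]; rewrite ?lexx ?ltr01// => -> _.
  by right.
by rewrite -edge_pt0 => /inj[]; rewrite ?lexx ?ltr01 ?s0// => -> ->; left.
Qed.

Lemma edge_meet i j s t : i <> j -> 0 <= s <= 1 -> 0 <= t <= 1 ->
  edge_pt v i s = edge_pt v j t ->
  (j = ordS i /\ s = 1) \/ (i = ordS j /\ t = 1).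
Proof.
case: knot => _ inj ij s01 t01.
have /andP[s0] := s01; rewrite le_eqVlt => /orP[/eqP ->|s1].
  rewrite edge_pt1 => /esym /(edge_vertex t01)[[-> _]|[/ordS_inj ji _]].
    by left.
  by case: ij.
have /andP[t0] := t01; rewrite le_eqVlt => /orP[/eqP ->|t1].
  rewrite edge_pt1 => /(edge_vertex s01)[[-> _]|[/ordS_inj ji _]].
    by right.
  by case: ij.
by move=> /inj[]; rewrite ?s0 ?t0.
Qed.

Lemma proj_edge_vertex i m s : 0 <= s <= 1 ->
  Defs.proj (edge_pt v i s) = pvertex v m -> i = m \/ ordS i = m.
Proof.
move=> s01 /(reg.2 _ _ (on_edge i s01)) /(edge_vertex s01).
by case=> [[-> _]|[-> _]]; [left|right].
Qed.

Lemma to_next_neq0 i : to_next v i != 0.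
Proof.
rewrite subr_eq0; apply/eqP => /(reg.2 _ _ (on_vertex _)).
rewrite -[in RHS](edge_pt0 i) -edge_pt0; case: knot => n2 inj /inj[].
- by rewrite lexx ltr01.
- by rewrite lexx ltr01.
- by move=> /eqP; rewrite (negbTE (ordS_neq _ _))// ltnW.
Qed.

Lemma to_prev_neq0 i : to_prev v i != 0.
Proof. by rewrite -(ord_predK i) to_prev_ordS oppr_eq0 to_next_neq0. Qed.

(** Regularity yields only that two of the three space points coincide. Two edges that meet in space
    share a vertex, and a third edge through the projection of that vertex would have to be one of
    the two. *)
Lemma no_triple_point i j k s t u : i <> j -> j <> k -> i <> k ->
  0 <= s <= 1 -> 0 <= t <= 1 -> 0 <= u <= 1 ->
  Defs.proj (edge_pt v i s) = Defs.proj (edge_pt v j t) ->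
  Defs.proj (edge_pt v j t) <> Defs.proj (edge_pt v k u).
Proof.
have main i' j' k' s' t' u' : i' <> j' -> j' <> k' -> i' <> k' ->
    0 <= s' <= 1 -> 0 <= t' <= 1 -> 0 <= u' <= 1 ->
    edge_pt v i' s' = edge_pt v j' t' ->
    Defs.proj (edge_pt v k' u') = Defs.proj (edge_pt v j' t') -> False.
  move=> ij jk ik s01 t01 u01 E.
  have [[jE s1]|[iE t1]] := edge_meet ij s01 t01 E.
    rewrite -E s1 edge_pt1 -jE => /(proj_edge_vertex u01)[kj|]; first exact: jk.
    by rewrite jE => /ordS_inj ki; apply: ik.
  rewrite t1 edge_pt1 -iE => /(proj_edge_vertex u01)[ki|]; first exact: ik.
  by rewrite iE => /ordS_inj kj; apply: jk.
move=> ij jk ik s01 t01 u01 E1 E2.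
have [E|[E|E]] := reg.1 _ _ _ (on_edge i s01) (on_edge j t01) (on_edge k u01) E1 E2.
- by apply: (main _ _ _ _ _ _ ij jk ik s01 t01 u01 E).
- by apply: (main _ _ _ _ _ _ jk (nesym ik) (nesym ij) t01 u01 s01 E); rewrite E1.
- by apply: (main _ _ _ _ _ _ ik (nesym jk) ij s01 u01 t01 E).
Qed.

(** Parameters are closed, so the common vertex of adjacent edges counts as a crossing. *)
Definition crossing i j s t := [/\ 0 <= s <= 1, 0 <= t <= 1 &
  Defs.proj (edge_pt v i s) = Defs.proj (edge_pt v j t)].

(* Overlapping parallel edges: following the overlap until the first endpoint
   puts a vertex of one edge on the other, which regularity forbids unless the
   edges are adjacent. *)
Lemma parallel_crossing i j s t a b : i <> j -> crossing i j s t ->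
  a *: to_next v i = b *: to_next v j -> a != 0 -> b != 0 ->
  (j = ordS i /\ (0 < a \/ b < 0)) \/ (i = ordS j /\ (a < 0 \/ 0 < b)).
Proof.
move=> ij [s01 t01 st] ab a0 b0.
have [l [l1 l2] lE] := square_exit s01 t01 a0 b0.
have {}st : Defs.proj (edge_pt v i (s + l * a)) = Defs.proj (edge_pt v j (t + l * b)).
  by rewrite !proj_edge_ptD st -!scalerA ab.
move: lE; case: (ltrgt0P a) a0 => //= a0 _; case: (ltrgt0P b) b0 => //= b0 _.
- case=> E; move: st; rewrite {}E edge_pt1.
    move=> /esym /(proj_edge_vertex l2)[-> |/ordS_inj ji]; last by case: ij.
    by left; split=> //; left.
  by move=> /(proj_edge_vertex l1)[-> |/ordS_inj ji]; [right; split=> //; right|case: ij].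
- case=> E; move: st; rewrite {}E ?edge_pt1 ?edge_pt0.
    move=> /esym /(proj_edge_vertex l2)[-> |/ordS_inj ji]; last by case: ij.
    by left; split=> //; left.
  by move=> /(proj_edge_vertex l1)[ji|<-]; [case: ij|left; split=> //; right].
- case=> E; move: st; rewrite {}E ?edge_pt1 ?edge_pt0.
    by move=> /esym /(proj_edge_vertex l2)[ji|<-]; [case: ij|right; split=> //; left].
  by move=> /(proj_edge_vertex l1)[-> |/ordS_inj ji]; [right; split=> //; right|case: ij].
- case=> E; move: st; rewrite {}E ?edge_pt1 ?edge_pt0.
    by move=> /esym /(proj_edge_vertex l2)[ji|<-]; [case: ij|right; split=> //; left].
  by move=> /(proj_edge_vertex l1)[ji|<-]; [case: ij|left; split=> //; right].
Qed.

Lemma crossing_diff i j s t s' t' : crossing i j s t -> crossing i j s' t' ->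
  (s' - s) *: to_next v i = (t' - t) *: to_next v j.
Proof.
move=> [_ _ E] [_ _ E'].
rewrite -[s'](subrKC s) -[t'](subrKC t) !proj_edge_ptD E in E'.
exact: addrI E'.
Qed.

Lemma scale_next_eq0 a b i j : a *: to_next v i = b *: to_next v j ->
  (a == 0) = (b == 0).
Proof.
move=> ab; apply/eqP/eqP => z; move: ab; rewrite z scale0r => /eqP.
  by rewrite eq_sym scaler_eq0 (negbTE (to_next_neq0 _)) orbF => /eqP.
by rewrite scaler_eq0 (negbTE (to_next_neq0 _)) orbF => /eqP.
Qed.

(** Two different crossings would make the edges parallel by [crossing_diff], and
    [parallel_crossing] would then make them adjacent. *)
Lemma crossing_unique i j s t s' t' : i <> j -> j <> ordS i -> i <> ordS j ->
  crossing i j s t -> crossing i j s' t' -> s = s' /\ t = t'.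
Proof.
move=> ij nji nij st st'; have ab := crossing_diff st st'.
have z := scale_next_eq0 ab; have [a0|a0] := eqVneq (s' - s) 0.
  move: z; rewrite a0 eqxx => /esym/eqP b0.
  by split; apply/esym/eqP; rewrite -subr_eq0; apply/eqP.
by have [[]|[]] := parallel_crossing ij st ab a0 (etrans (esym (congr1 negb z)) a0).
Qed.

(** Any crossing is compared with the common vertex, at [(1, 0)]. A different one would be a
    parallel overlap, whose sign conditions in [parallel_crossing] contradict [s <= 1] and [0 <= t];
    the other alternative there is excluded by [2 < n]. *)
Lemma crossing_adjacent i s t : crossing i (ordS i) s t -> s = 1 /\ t = 0.
Proof.
have n2 := knot.1; move=> st.
have ij : i <> ordS i by apply/eqP; rewrite eq_sym ordS_neq// ltnW.
have v10 : crossing i (ordS i) 1 0.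
  by split; rewrite ?lexx ?ler01// edge_pt1 edge_pt0.
have ab := crossing_diff v10 st.
have z := scale_next_eq0 ab; have [a0|a0] := eqVneq (s - 1) 0.
  move: z; rewrite a0 eqxx => /esym/eqP; rewrite subr0 => ->.
  by split=> //; apply/eqP; rewrite -subr_eq0 a0.
have b0 : t - 0 != 0 by rewrite -z.
have [[_ []]|[iE _]] := parallel_crossing ij st ab a0 b0.
- by case: st => ? ? _; lra.
- by case: st => ? ? _; lra.
- by have := ordS2_neq i n2; rewrite -iE eqxx.
Qed.

(** Projection and height determine a point, so equal heights would make nonadjacent edges meet in
    space. *)
Lemma crossing_height i j s t : i <> j -> j <> ordS i -> i <> ordS j ->
  crossing i j s t -> height (edge_pt v i s) != height (edge_pt v j t).
Proof.
move=> ij nji nij [s01 t01 st]; apply/eqP => h.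
have E : edge_pt v i s = edge_pt v j t.
  apply: (etrans (esym (@hsubmxK _ 1 2 1 (edge_pt v i s)))).
  apply: etrans (@hsubmxK _ 1 2 1 (edge_pt v j t)); congr row_mx => //.
  apply/rowP => k; rewrite !mxE ord1.
  have -> : rshift 2 0 = ord_max :> 'I_3 by apply/val_inj.
  by move: h; rewrite /height !mxE.
by have [[]|[]] := edge_meet ij s01 t01 E.
Qed.

End Knot.

(** * The strip of an edge and its coordinates *)

Section Ribbon.
Variables (R : realType) (n : nat) (v : 'I_n -> 'rV[R]_3).
Hypotheses (knot : polygonal_knot v) (reg : regular_diagram v).
Implicit Types (i j k : 'I_n) (w : R) (x y z : rpoint R n).

Local Notation h := (half_section v 1).
Local Notation h' i := (side_change v i *: half_section v 1 i).

(** Separates the centerline from a displacement linear in [w]. Here [h'] is the end section with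
    its sides labelled as seen from the incoming edge. *)
Lemma ribbon_mapE w x : ribbon_map v w x =
  Defs.proj (knot_pt v x) + (w * across x) *: ((1 - along x) *: h (edge_of x)
    + along x *: h' (ordS (edge_of x))).
Proof.
rewrite /knot_pt proj_edge_pt /ribbon_map /= ![half_section v w _]half_sectionZ.
move: (pvertex _ _) (pvertex _ _) (half_section _ _ _) (half_section _ _ _).
by move=> a b c d; apply/rowP => k; rewrite !(rvD, rvZ); ring.
Qed.

(** The two end sections have the same normal component, so [along] drops out and the normal
    coordinate determines [across]. *)
Lemma ribbon_normal w x :
  dotp (ribbon_map v w x - pvertex v (edge_of x)) (rot90 (to_next v (edge_of x)))
  = w * across x * (enorm (to_next v (edge_of x)) / 2).
Proof.
rewrite ribbon_mapE /knot_pt -[along x]add0r proj_edge_ptD edge_pt0 add0r.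
set i := edge_of x.
have hn := dotp_half_next (to_prev_neq0 knot reg i) (to_next_neq0 knot reg i).
have hp := dotp_half_prev (to_prev_neq0 knot reg (ordS i))
  (to_next_neq0 knot reg (ordS i)).
have {hp} : dotp (h' (ordS i)) (rot90 (to_next v i)) = enorm (to_next v i) / 2.
  move: hp; rewrite to_prev_ordS -scaleN1r dotp_rot90Z => hp.
  have := congr1 -%R hp; rewrite mulN1r !opprK => ->; congr (_ / _).
  by congr Num.sqrt; rewrite !dotpE; ring.
move: hn; rewrite -[Defs.proj (v i)]/(pvertex v i).
move: (to_next v i) (h i) (h' (ordS i)) (pvertex v i) => e a b p ha hb.
transitivity (w * across x * ((1 - along x) * dotp a (rot90 e) +
    along x * dotp b (rot90 e))); first by rewrite !dotpE; ring.
by rewrite ha hb; ring.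
Qed.

Lemma ribbon_tangent w x (e : 'rV[R]_2) :
  dotp (ribbon_map v w x - pvertex v (edge_of x)) e =
  along x * dotp (to_next v (edge_of x)) e +
  w * across x * ((1 - along x) * dotp (h (edge_of x)) e
    + along x * dotp (h' (ordS (edge_of x))) e).
Proof.
rewrite ribbon_mapE /knot_pt -[in Defs.proj _](add0r (along x)) proj_edge_ptD edge_pt0.
rewrite -[Defs.proj (v _)]/(pvertex v _).
move: (edge_of x) => i; move: (to_next v i) (h i) (h' (ordS i)) (pvertex v i).
by move=> f a b p; rewrite !dotpE; ring.
Qed.

(* Keeps the slanted ends of the strip of an edge from meeting. *)
Definition thin_strip w i := w * (`|dotp (h i) (to_next v i)| +
  `|dotp (h' (ordS i)) (to_next v i)|) < dotp (to_next v i) (to_next v i).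

(** The normal coordinate gives [across]. The tangential coordinate is then affine in [along], with
    a slope that [thin_strip] keeps positive. *)
Lemma strip_injective w x y : 0 < w -> thin_strip w (edge_of x) ->
  in_ribbon x -> in_ribbon y -> edge_of x = edge_of y ->
  ribbon_map v w x = ribbon_map v w y -> x = y.
Proof.
case: x y => [i s c] [j t d] w0 thin [/= s01 c1] [/= t01 d1] ij; rewrite -{j}ij => E.
have := ribbon_normal w (RPoint i s c); have := ribbon_normal w (RPoint i t d).
rewrite E /= => -> cd.
have e0 : 0 < enorm (to_next v i) / 2.
  by rewrite divr_gt0// enorm_gt0// to_next_neq0.
have {cd} dc : d = c.
  by apply: (mulfI (lt0r_neq0 w0)); apply: (mulIf (lt0r_neq0 e0)).
subst d.
have := ribbon_tangent w (RPoint i s c) (to_next v i).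
have := ribbon_tangent w (RPoint i t c) (to_next v i).
rewrite E /= => -> /eqP.
rewrite /thin_strip in thin; move: thin.
move: (dotp (h i) _) (dotp (h' (ordS i)) _) => a b; set D := dotp _ _ => thin /eqP E'.
congr RPoint.
have ab : `|w * c * (b - a)| < D.
  apply: (le_lt_trans _ thin); rewrite !normrM (gtr0_norm w0) -mulrA ler_pM2l//.
  have c1' : `|c| <= 1 by rewrite ler_norml.
  by rewrite (le_trans (ler_piMl (normr_ge0 _) c1'))// [leRHS]addrC ler_normB.
have st : (s - t) * (D + w * c * (b - a)) = 0 by lra.
move/eqP: st; rewrite mulf_eq0 subr_eq0 => /orP[/eqP//|/eqP D0].
by move: ab; rewrite ltr_norml => /andP[? ?]; lra.
Qed.

(** The bounds make [B + w * d * b] and [A - w * c * a] positive, so the left side of the equation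
    is nonnegative and the right side nonpositive. Hence both vanish. *)
Lemma opposite_sides (w a b A B p q s t c d : R) : 0 < w -> 0 < p -> 0 < q ->
  w * `|a| < A -> w * `|b| < B -> 0 <= s <= 1 -> 0 <= t <= 1 ->
  -1 <= c <= 1 -> -1 <= d <= 1 ->
  p * (t * B + w * d * (t * b)) = q * ((1 - s) * (w * c * a - A)) ->
  s = 1 /\ t = 0.
Proof.
move=> w0 p0 q0 aA bB /andP[s0 s1] /andP[t0 t1] c1 d1 E.
have bound (r k : R) : -1 <= k <= 1 -> `|w * k * r| <= w * `|r|.
  move=> k1; have {}k1 : `|k| <= 1 by rewrite ler_norml.
  by rewrite !normrM (gtr0_norm w0) -mulrA ler_pM2l// ler_piMl.
have /ler_normlP[_ a1] := bound a c c1.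
have /ler_normlP[b1 _] := bound b d d1.
have A0 : 0 < q * (A - w * c * a) by rewrite mulr_gt0//; lra.
have B0 : 0 < p * (B + w * d * b) by rewrite mulr_gt0//; lra.
have {}E : t * (p * (B + w * d * b)) + (1 - s) * (q * (A - w * c * a)) = 0.
  by lra.
move/eqP: E; rewrite paddr_eq0; last 2 first.
- by rewrite mulr_ge0// ltW.
- by rewrite mulr_ge0 ?subr_ge0// ltW.
rewrite mulf_eq0 (gt_eqF B0) mulf_eq0 (gt_eqF A0) !orbF subr_eq0.
by move=> /andP[/eqP -> /eqP ->].
Qed.

(** At an unfolded vertex both edges run in one direction, and thinness keeps each strip on its own
    side of the common perpendicular section. Equal images thus lie on that section. *)
Lemma unfolded_strips w x y : 0 < w -> thin_strip w (edge_of x) ->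
  thin_strip w (edge_of y) -> in_ribbon x -> in_ribbon y ->
  edge_of y = ordS (edge_of x) -> ~~ has_fold v (edge_of y) ->
  ribbon_map v w x = ribbon_map v w y -> glued_next v x y.
Proof.
case: x y => [i s c] [j t d] w0 thini thinj [/= s01 c1] [/= t01 d1] ij.
subst j; set j := ordS i in thinj * => unfold E.
have p0 := to_prev_neq0 knot reg j; have n0 := to_next_neq0 knot reg j.
have [hn hp] := dotp_half_unfold p0 n0 unfold.
have ep := enorm_gt0 p0; have en := enorm_gt0 n0.
have ni : to_next v i = enorm (to_prev v j) *: dirv (to_next v j).
  rewrite -[LHS]opprK -to_prev_ordS -/j -{1}(dirvK p0) (dirv_unfold p0 n0 unfold).
  by rewrite scalerN opprK.
(* Scaling the edge vectors to a common one makes the tangential coordinates in the two strips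
   comparable. *)
have fe : enorm (to_prev v j) *: to_next v j = enorm (to_next v j) *: to_next v i.
  by rewrite ni -{1}(dirvK n0) !scalerA; congr (_ *: _); ring.
have sc : side_change v j = 1 by exact: side_change_unfold.
have := ribbon_tangent w (RPoint j t d) (to_next v j); rewrite -E /= hn.
have := ribbon_tangent w (RPoint i s c) (to_next v i) => /=.
rewrite -/j sc scale1r => Ti Tj.
have hi0 : dotp (h j) (to_next v i) = 0.
  rewrite -[to_next v i]opprK -to_prev_ordS -/j.
  by move: hp; rewrite !dotpE; lra.
rewrite /thin_strip -/j sc scale1r hi0 normr0 addr0 in thini.
rewrite /thin_strip hn normr0 add0r in thinj.
rewrite hi0 mulr0 addr0 in Ti; rewrite mulr0 add0r in Tj.
set X := ribbon_map _ _ _ in Ti Tj; set a := dotp _ _ in thini Ti.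
set b := dotp _ _ in thinj Tj; set A := dotp _ _ in thini Ti.
set B := dotp (to_next v j) _ in thinj Tj.
(* The tangential coordinate in the first strip is measured anew from the shared vertex. *)
have XE : dotp (X - pvertex v j) (to_next v i) = (1 - s) * (w * c * a - A).
  have -> : X - pvertex v j = X - pvertex v i - to_next v i.
    by rewrite /to_next opprB addrA subrK.
  have -> : dotp (X - pvertex v i - to_next v i) (to_next v i) =
      dotp (X - pvertex v i) (to_next v i) - A.
    by rewrite /A; move: (to_next v i) (X - _) => e z; rewrite !dotpE; ring.
  by rewrite Ti; ring.
have XF : enorm (to_prev v j) * dotp (X - pvertex v j) (to_next v j) =
    enorm (to_next v j) * dotp (X - pvertex v j) (to_next v i).
  have dZ r (z e : 'rV[R]_2) : r * dotp z e = dotp z (r *: e).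
    by rewrite !dotpE; ring.
  by rewrite !dZ fe.
rewrite XE Tj in XF.
have [s1 t0] := opposite_sides w0 ep en thini thinj s01 t01 c1 d1 XF.
split; rewrite /= -/j ?sc ?mul1r; [exact: s1|by []|exact: t0|].
move: E; rewrite /ribbon_map /= s1 t0 -/j sc !mul1r subrr subr0.
rewrite !scale0r !scale1r add0r addr0.
(* Equal images on the section give equal [across] unless the section is zero, which its normal
   component excludes. *)
move=> /addrI/eqP; rewrite -subr_eq0 -scalerBl scaler_eq0 => /orP[|/eqP h0].
  by rewrite subr_eq0 => /eqP ->.
have := dotp_half_next p0 n0.
have : dotp (half_section v w j) (rot90 (to_next v j)) = 0.
  by rewrite h0 !dotpE !mxE; ring.
rewrite half_sectionZ; set H := half_section v 1 j => wH HE.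
have : w * dotp H (rot90 (to_next v j)) = 0 by rewrite -wH !dotpE; ring.
by rewrite HE; nra.
Qed.

(** * Estimates for small width *)

(** Bounds the displacement from the centerline per unit of width. The sup norm suffices, as only
    linearity of the bound in [w] matters. *)
Definition ribbon_spread i := `|h i| + `|h' (ordS i)|.

Lemma ribbon_spreadP w x : 0 < w -> in_ribbon x ->
  `|ribbon_map v w x - Defs.proj (knot_pt v x)| <=
  w * ribbon_spread (edge_of x).
Proof.
move=> w0 [/andP[s0 s1] c1].
rewrite ribbon_mapE addrC addKr normrZ normrM gtr0_norm// -mulrA.
rewrite ler_pM2l//; have {}c1 : `|across x| <= 1 by rewrite ler_norml.
apply: le_trans (ler_piMl (normr_ge0 _) c1) _.
apply: le_trans (ler_normD _ _) _; rewrite /ribbon_spread.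
move: (h _) (h' _) => a b; rewrite !normrZ !ger0_norm ?subr_ge0//.
by apply: lerD; rewrite ler_piMl// lerBlDr lerDl.
Qed.

(** Together with [thin_strip], this is all that the verification for a thin ribbon uses of the
    smallness of [w]. *)
Definition no_triple_overlap w := forall x y z, in_ribbon x -> in_ribbon y ->
  in_ribbon z -> edge_of x <> edge_of y -> edge_of y <> edge_of z ->
  edge_of x <> edge_of z -> ribbon_map v w x = ribbon_map v w y ->
  ribbon_map v w y <> ribbon_map v w z.

Lemma near_thin (a b : R) : 0 < b -> \forall w \near at_right (0 : R), w * a < b.
Proof.
move=> b0; near=> w; have w0 : 0 < w by near: w; exact: nbhs_right_gt.
(* The added 1 keeps the divisor positive when [a = 0]. *)
have a0 : 0 < `|a| + 1 by rewrite ltr_pwDr.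
have wb : w < b / (`|a| + 1) by near: w; apply: nbhs_right_lt; rewrite divr_gt0.
rewrite ltr_pdivlMr// in wb; apply: le_lt_trans wb.
by rewrite ler_pM2l// (le_trans (ler_norm a))// lerDl.
Unshelve. all: by end_near. Qed.

Lemma near_thin_strips : \forall w \near at_right (0 : R), forall i, thin_strip w i.
Proof.
apply: filter_forall => i; apply: near_thin.
by rewrite -sqr_enorm exprn_gt0// enorm_gt0// to_next_neq0.
Qed.

Lemma continuous_edge i : continuous (fun s : R => Defs.proj (edge_pt v i s)).
Proof.
have -> : (fun s : R => Defs.proj (edge_pt v i s)) =
    (fun s => pvertex v i + s *: to_next v i).
  by apply/funext => s; rewrite -[s in LHS]add0r proj_edge_ptD edge_pt0.
by move=> s; apply: cvgD; [exact: cvg_cst|apply: cvgZr_tmp; exact: cvg_id].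
Qed.

Lemma dist_le (V : normedModType R) (p a b : V) (A B : R) :
  `|p - a| <= A -> `|p - b| <= B -> `|a - b| <= A + B.
Proof.
move=> pa pb; apply: le_trans (ler_distD p a b) _.
by rewrite lerD// distrC.
Qed.

(** For three distinct edges [separated_curves] gives a gap [m] between the centerlines, whereas a
    triple overlap brings three centerline points within a constant multiple of [w]. There are
    finitely many triples of edges. *)
Lemma near_no_triple_overlap : \forall w \near at_right (0 : R), no_triple_overlap w.
Proof.
have tri i j k : i <> j -> j <> k -> i <> k -> \forall w \near at_right (0 : R),
    forall x y z, in_ribbon x -> in_ribbon y -> in_ribbon z ->
    edge_of x = i -> edge_of y = j -> edge_of z = k ->
    ribbon_map v w x = ribbon_map v w y -> ribbon_map v w y <> ribbon_map v w z.
  move=> ij jk ik.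
  have [s t u ? ? ?|m m0 mP] := separated_curves (@continuous_edge i)
    (@continuous_edge j) (@continuous_edge k).
    exact: no_triple_point.
  near=> w => x y z xr yr zr xi yj zk xy yz.
  have w0 : 0 < w by near: w; exact: nbhs_right_gt.
  have : m <= (w * ribbon_spread i + w * ribbon_spread j) +
      (w * ribbon_spread j + w * ribbon_spread k).
    apply: (le_trans (mP _ _ _ xr.1 yr.1 zr.1)).
    have := ribbon_spreadP w0 zr; rewrite -yz zk /knot_pt zk => Dz.
    have := ribbon_spreadP w0 yr; rewrite yj /knot_pt yj => Dy.
    have := ribbon_spreadP w0 xr; rewrite xy xi /knot_pt xi => Dx.
    by apply: lerD; [exact: dist_le Dx Dy|exact: dist_le Dy Dz].
  apply/negP; rewrite -!mulrDr -ltNge; near: w; exact: near_thin.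
have : \forall w \near at_right (0 : R), forall i j k, i <> j -> j <> k -> i <> k ->
    forall x y z, in_ribbon x -> in_ribbon y -> in_ribbon z ->
    edge_of x = i -> edge_of y = j -> edge_of z = k ->
    ribbon_map v w x = ribbon_map v w y -> ribbon_map v w y <> ribbon_map v w z.
  apply: filter_forall => i; apply: filter_forall => j; apply: filter_forall => k.
  (* Triples with a repeated edge satisfy the claim vacuously. *)
  have [e|ij] := pselect (i = j); first by apply: nearW => w /(_ e) [].
  have [e|jk] := pselect (j = k); first by apply: nearW => w _ /(_ e) [].
  have [e|ik] := pselect (i = k); first by apply: nearW => w _ _ /(_ e) [].
  by have := tri i j k ij jk ik; apply: filterS => w + _ _ _; exact.
apply: filterS => w P x y z xr yr zr xy yz xz.
exact: (P _ _ _ xy yz xz).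
Unshelve. all: by end_near. Qed.

End Ribbon.

(** * A thin ribbon is immersed off its folds, with disjoint fold lines *)

Section ThinRibbon.
Variables (R : realType) (n : nat) (v : 'I_n -> 'rV[R]_3) (w : R).
Variable F : 'I_n -> folding.
Hypotheses (knot : polygonal_knot v) (reg : regular_diagram v).
Hypotheses (w0 : 0 < w) (thin : forall i, thin_strip v w i).
Hypothesis no_triple : no_triple_overlap v w.
Implicit Types (i j : 'I_n) (x y z : rpoint R n).

Lemma ordS_nfix i : i <> ordS i.
Proof. by apply/eqP; rewrite eq_sym ordS_neq// ltnW//; case: knot. Qed.

Lemma glued_ribbon_map x y : glued_next v x y ->
  ribbon_map v w x = ribbon_map v w y.
Proof.
case: x y => [i s c] [j t d] [/= -> -> -> ->].
by rewrite /ribbon_map /= subrr subr0 !scale0r !scale1r addr0 add0r.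
Qed.

Lemma same_rpoint_sym x y : same_rpoint v x y -> same_rpoint v y x.
Proof. by case=> [->|[xy|yx]]; [left|right; right|right; left]. Qed.

Lemma double_point_sym x y : double_point v w x y -> double_point v w y x.
Proof.
case=> xr yr xy E; split; [exact: yr|exact: xr| |exact: esym].
by move=> /same_rpoint_sym.
Qed.

Lemma side_change_bound i (c : R) : -1 <= c <= 1 -> -1 <= side_change v i * c <= 1.
Proof. by rewrite /side_change; case: ifP => _ c1; apply/andP; split; lra. Qed.

Lemma glued_prev i (c : R) :
  glued_next v (RPoint (ord_pred i) 1 (side_change v i * c)) (RPoint i 0 c).
Proof.
by split; rewrite //= ?ord_predK// mulrA side_change_sqr mul1r.
Qed.

(** The twin is the other representative in the gluing class. It shows that a section lies on two
    strips, so that any further strip meeting it would produce a triple overlap. *)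
Lemma section_twin x : in_ribbon x -> along x = 0 \/ along x = 1 ->
  exists y, [/\ in_ribbon y, same_rpoint v x y, edge_of x <> edge_of y
    & ribbon_map v w y = ribbon_map v w x].
Proof.
case: x => [i s c] [/= s01 c1] [] s0; subst s.
  pose y := RPoint (ord_pred i) 1 (side_change v i * c).
  have yx : glued_next v y (RPoint i 0 c) by exact: glued_prev.
  exists y; split.
  - by split=> /=; [rewrite ler01 lexx|exact: side_change_bound].
  - by right; right.
  - by rewrite /= => ii; apply: (@ordS_nfix (ord_pred i)); rewrite ord_predK.
  - exact: glued_ribbon_map.
pose y := RPoint (ordS i) 0 (side_change v (ordS i) * c).
have xy : glued_next v (RPoint i 1 c) y by [].
exists y; split.
- by split=> /=; [rewrite ler01 lexx|exact: side_change_bound].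
- by right; left.
- exact: ordS_nfix.
- by rewrite (glued_ribbon_map xy).
Qed.

Lemma double_point_edges x y : double_point v w x y -> edge_of x <> edge_of y.
Proof.
move=> [xr yr xy E] e; apply: xy; left.
exact: (strip_injective knot reg w0 (thin _) xr yr e E).
Qed.

(** If [x] lay on a section, its twin would give a third strip over the same point, unless the twin
    is on the strip of [y]. In that case it equals [y] by injectivity, and [x] and [y] are glued. *)
Lemma double_point_inner x y : double_point v w x y -> 0 < along x < 1.
Proof.
move=> xyd; have exy := double_point_edges xyd; case: xyd => xr yr xy E.
have [/andP[s0 s1] _] := xr; rewrite !lt_neqAle s0 s1 !andbT.
apply/negbNE/negP; rewrite negb_and !negbK => s01.
have [|z [zr xz exz Ez]] := section_twin xr.
  by case/orP: s01 => /eqP ->; [left|right].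
have [eyz|eyz] := pselect (edge_of y = edge_of z).
  apply: xy; suff -> : y = z by [].
  exact: (strip_injective knot reg w0 (thin _) yr zr eyz (etrans (esym E) (esym Ez))).
exact: (no_triple zr xr yr (nesym exz) exy (nesym eyz) Ez E).
Qed.

(** Gluing classes are trivial away from the sections, so any relation on double points is well
    defined on the glued surface. *)
Lemma double_point_same x x' y : double_point v w x y -> same_rpoint v x x' ->
  x = x'.
Proof.
move=> /double_point_inner /andP[s0 s1] [-> //|[] [sx _ sx' _]].
  by move: s1; rewrite sx ltxx.
by move: s0; rewrite sx' ltxx.
Qed.

Lemma thin_immersed : immersed_off_folds v w.
Proof.
(* Any radius works: closeness fixes the edge, and injectivity holds on whole strips. *)
move=> x y xr yr xy xf; exists 1; first exact: ltr01.
move=> x' y' xr' yr' [ex _ _] [ey _ _] E.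
case: xy => [xy|[[x1 yx y0 _]|[y1 xy x0 _]]].
- left; apply: (strip_injective knot reg w0 (thin _) xr' yr' _ E).
  by rewrite -ex -ey xy.
- right; left; apply: (unfolded_strips knot reg w0 (thin _) (thin _) xr' yr' _ _ E).
    by rewrite -ex -ey.
  apply/negP => fold; apply: xf; right; split; [exact: x1|rewrite -yx ey; exact: fold].
- right; right; apply: (unfolded_strips knot reg w0 (thin _) (thin _)
    yr' xr' _ _ (esym E)).
    by rewrite -ex -ey.
  apply/negP => fold; apply: xf; left; split; [exact: x0|rewrite ex; exact: fold].
Qed.

(** A fold line lies on both strips at its vertex. Two fold lines that meet would involve three
    different strips, even at adjacent vertices, since [2 < n]. *)
Lemma thin_disjoint_folds : disjoint_folds v w.
Proof.
move=> i j /eqP ij _ _ p [t [t1 pi]] [u [u1 pj]].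
have sec k (c : R) : pvertex v k + c *: half_section v w k =
    ribbon_map v w (RPoint k 0 c).
  by rewrite /ribbon_map /= subr0 scale0r scale1r addr0.
have xr (k : 'I_n) (c : R) : -1 <= c <= 1 -> in_ribbon (RPoint k 0 c).
  by split; rewrite //= lexx ler01.
have twin k (c : R) : -1 <= c <= 1 ->
    exists y, [/\ in_ribbon y, edge_of y = ord_pred k &
      ribbon_map v w y = ribbon_map v w (RPoint k 0 c)].
  move=> c1; exists (RPoint (ord_pred k) 1 (side_change v k * c)); split.
  - by split=> /=; [rewrite ler01 lexx|exact: side_change_bound].
  - by [].
  - exact/glued_ribbon_map/glued_prev.
have [x' [xr' ex' Ex']] := twin i t t1; have [y' [yr' ey' Ey']] := twin j u u1.
have E : ribbon_map v w (RPoint i 0 t) = ribbon_map v w (RPoint j 0 u).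
  by rewrite -!sec -pi -pj.
have pred_nfix (k : 'I_n) : ord_pred k <> k.
  by move=> e; apply: (@ordS_nfix (ord_pred k)); rewrite ord_predK.
have [ji|ji] := pselect (j = ord_pred i).
  have jy : j <> edge_of y' by rewrite ey'; exact/nesym/pred_nfix.
  have iy : i <> edge_of y'.
    rewrite ey'; have [n2 _] := knot; have := ordS2_neq (ord_pred j) n2.
    by rewrite ord_predK [in ordS j]ji ord_predK => /eqP.
  exact: (no_triple (xr i t t1) (xr j u u1) yr' ij jy iy E (esym Ey')).
have xi : edge_of x' <> i by rewrite ex'; exact: pred_nfix.
have xj : edge_of x' <> j by rewrite ex'; exact: nesym.
exact: (no_triple xr' (xr i t t1) (xr j u u1) xi ij xj Ex' E).
Qed.

(** * Crossing information, edge by edge *)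

Definition crosses_over i j := exists s t, crossing v i j s t /\
  height (edge_pt v j t) < height (edge_pt v i s).

(* The last disjunct is an arbitrary order for nonadjacent edges that do not
   cross. *)
Definition edge_over i j : Prop :=
  if j == ord_pred i then F i = Overfold
  else if i == ord_pred j then F j = Underfold
  else crosses_over i j \/ (~ crosses_over j i /\ (i < j)%N).

Lemma crossing_sym i j s t : crossing v i j s t -> crossing v j i t s.
Proof. by case. Qed.

(** The crossing is unique, so both relations compare the same two heights. *)
Lemma crosses_over_asym i j : i <> j -> j <> ordS i -> i <> ordS j ->
  crosses_over i j -> ~ crosses_over j i.
Proof.
move=> ij nji nij [s [t [st h]]] [t' [s' [/crossing_sym ts h']]].
have [ss tt] := crossing_unique knot reg ij nji nij st ts.
by move: h h'; rewrite ss tt => h /(lt_trans h); rewrite ltxx.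
Qed.

Lemma eq_pred i j : (j == ord_pred i) = (i == ordS j).
Proof. by rewrite -(inj_eq (@ordS_inj n)) ord_predK eq_sym. Qed.

Lemma edge_over_asym i j : i <> j -> edge_over i j <-> ~ edge_over j i.
Proof.
have [n2 _] := knot.
move=> ij; rewrite /edge_over !eq_pred.
have [iS|nij] := eqVneq i (ordS j).
  (* As [2 < n], two edges cannot each be the successor of the other, so a single fold decides both
     directions. *)
  have -> : (j == ordS i) = false.
    by rewrite iS; apply/negbTE; rewrite eq_sym ordS2_neq.
  by case: (F i).
have [jS|nji] := eqVneq j (ordS i); first by case: (F j).
move: nij nji => /eqP nij /eqP nji.
have aij := crosses_over_asym ij nji nij.
have aji := crosses_over_asym (nesym ij) nij nji.
have [cij|ncij] := pselect (crosses_over i j).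
  by split=> [_|_]; [case=> [/(aij cij)|[/(_ cij)]]|left].
have [cji|ncji] := pselect (crosses_over j i).
  by split=> [[//|[]//]|H]; case: H; left.
(* Without a crossing the order of the indices decides. *)
have [lt_ij|lt_ji|/val_inj//] := ltngtP i j.
  by split=> [_ [//|[]//]|_]; right.
by split=> [[//|[]//]|H]; case: H; right.
Qed.

Lemma thin_consistent : consistent_crossings v w
  (fun x y => edge_over (edge_of x) (edge_of y)).
Proof.
split.
- move=> x x' y y' xy xy' xx yy.
  have <- := double_point_same xy xx.
  by have <- := double_point_same (double_point_sym xy) yy.
- by move=> x y /double_point_edges; exact: edge_over_asym.
- move=> x y z xy yz oxy oyz.
  have exy := double_point_edges xy; have eyz := double_point_edges yz.
  case: xy yz => xr yr _ Exy [_ zr _ Eyz].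
  (* A return to the edge of [x] contradicts asymmetry, and three different edges would form a
     triple overlap. *)
  have [exz|exz] := pselect (edge_of x = edge_of z).
    by case/(edge_over_asym exy): oxy; rewrite exz.
  by case: (no_triple xr yr zr exy eyz exz Exy Eyz).
- by move=> x y _; exists 1; [exact: ltr01|move=> x' y' _ [<- _ _] [<- _ _]].
Qed.

Lemma thin_agrees_with_folding : agrees_with_folding v F w
  (fun x y => edge_over (edge_of x) (edge_of y)).
Proof.
move=> x y xy yx _; have exy := double_point_edges xy.
have := @edge_over_asym _ _ exy; case EF : (F (edge_of x)).
  by move=> _; rewrite /edge_over yx eqxx.
move=> [_ H]; apply: contrapT => /H.
by rewrite /edge_over yx eqxx EF.
Qed.

Lemma thin_agrees_with_diagram : agrees_with_diagram v w
  (fun x y => edge_over (edge_of x) (edge_of y)).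
Proof.
move=> x y xy x0 y0; have exy := double_point_edges xy.
have xs := double_point_inner xy.
have ys := double_point_inner (double_point_sym xy).
have st : crossing v (edge_of x) (edge_of y) (along x) (along y).
  case: xy => -[sx _] [sy _] _; rewrite !ribbon_mapE x0 y0 mulr0 !scale0r !addr0.
  by move=> E; exact: And3 sx sy E.
(* Adjacent edges cross only at their common vertex, whereas double points are interior to both
   edges. *)
have nyx : edge_of y <> ordS (edge_of x).
  move=> e; move: st; rewrite e => /(crossing_adjacent knot reg)[s1 _].
  by move: xs; rewrite s1 ltxx andbF.
have nxy : edge_of x <> ordS (edge_of y).
  move=> e; move: st; rewrite e => /crossing_sym /(crossing_adjacent knot reg)[s1 _].
  by move: ys; rewrite s1 ltxx andbF.
have hne := crossing_height knot exy nyx nxy st.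
have cr : crosses_over (edge_of x) (edge_of y) <->
    height (knot_pt v y) < height (knot_pt v x).
  split=> [[s [t [st' h]]]|h]; last by exists (along x), (along y).
  by have [ss tt] := crossing_unique knot reg exy nyx nxy st st'; rewrite /knot_pt ss tt.
rewrite -cr /edge_over !eq_pred (negbTE (introN eqP nxy)) (negbTE (introN eqP nyx)).
(* The default order by index cannot reverse the heights: a crossing with different heights puts one
   edge over the other. *)
split=> [[//|[ncyx _]]|]; last by left.
apply/cr; move: hne; rewrite neq_lt => /orP[h|//].
case: ncyx; exists (along y), (along x); split=> //; exact: crossing_sym.
Qed.

End ThinRibbon.

Theorem corollary22 (R : realType) (n : nat) (v : 'I_n -> 'rV[R]_3)
    (F : 'I_n -> folding) :
  polygonal_knot v -> regular_diagram v ->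
  exists2 M : R, 0 < M & forall w : R, 0 < w < M -> allowed v F w.
Proof.
move=> knot reg.
(* The smallness conditions are collected as eventual properties of [w] tending to 0 from the
   right. *)
have : \forall w \near at_right (0 : R), allowed v F w.
  near=> w.
  have w0 : 0 < w by near: w; exact: nbhs_right_gt.
  have thin : forall i, thin_strip v w i by near: w; exact: near_thin_strips.
  have no_triple : no_triple_overlap v w by near: w; exact: near_no_triple_overlap.
  split.
  - exact: thin_immersed.
  - exact: thin_disjoint_folds.
  - exists (fun x y => edge_over v F (edge_of x) (edge_of y)); split.
    + exact: thin_consistent.
    + exact: thin_agrees_with_folding.
    + exact: thin_agrees_with_diagram.
(* The radius of a ball around 0 witnessing the eventual property serves as [M]. *)
move=> /nbhs_ballP[M /= M0 MP]; exists M => // w /andP[w0 wM].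
by apply: MP => //=; rewrite /ball/= sub0r normrN gtr0_norm.
Unshelve. all: by end_near. Qed.
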